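(* Let $n\ge 0$ be an integer and let $P(z)=\sum_{i=0}^{n}A_i z^i$ be a random polynomial whose coefficients $A_0,\dots,A_n$ are independent standard normal random variables, $A_i\sim N(0,1)$. Let $z$ be chosen uniformly at random on the unit circle $|z|=1$, independently of the coefficients. Then for every $c>0$, $$\mathbb{P}\big(|P(z)|>c\sqrt{n+1}\big)\le\frac{1}{c^2}.$$
   Context: The coefficients are real-valued. ''Uniformly chosen $z$ on $|z|=1$'' means $z=e^{it}$ with $t$ uniformly distributed on $[0,2\pi]$; the probability is taken jointly over the coefficients and $z$. *)

(* Defs.v *)
From HB Require Import structures.
From mathcomp Require Import all_boot all_order all_algebra.
From mathcomp Require Import all_classical all_reals all_analysis.
From mathcomp Require Import complex.

Set Implicit Arguments.
Unset Strict Implicit.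
Unset Printing Implicit Defensive.

Import Order.TTheory GRing.Theory Num.Theory.
Import numFieldNormedType.Exports.

Local Open Scope classical_set_scope.
Local Open Scope ring_scope.
Local Open Scope complex_scope.

Definition mutually_independent (d d' : measure_display) (T : measurableType d)
    (S : measurableType d') (R : realType) (P : probability T R)
    (I : finType) (X : I -> T -> S) : Prop :=
  forall (J : {set I}) (B : I -> set S),
    (forall i, i \in J -> measurable (B i)) ->
    P (\bigcap_(i in [set` J]) (X i @^-1` B i)) =
    (\prod_(i in J) P (X i @^-1` B i))%E.

Definition independent2 (d d1 d2 : measure_display) (T : measurableType d)
    (S1 : measurableType d1) (S2 : measurableType d2) (R : realType)
    (P : probability T R) (X : T -> S1) (Y : T -> S2) : Prop :=
  forall (B : set S1) (C : set S2), measurable B -> measurable C ->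
    P ((X @^-1` B) `&` (Y @^-1` C)) = (P (X @^-1` B) * P (Y @^-1` C))%E.

(* Only measurable events are compared: the values of a measure outside the
   sigma-algebra are unconstrained. *)
Definition has_law (d d' : measure_display) (T : measurableType d)
    (S : measurableType d') (R : realType) (P : probability T R)
    (X : {RV P >-> S}) (mu : set S -> \bar R) : Prop :=
  forall B : set S, measurable B -> distribution P X B = mu B.

Lemma pi2_gt0 (R : realType) : 0 < 2 * pi :> R.
Proof. by rewrite mulr_gt0 ?pi_gt0. Qed.

Definition expi (R : realType) (t : R) : R[i] := cos t +i* sin t.

(* The library puts no sigma-algebra on R[i]; Borel sets of the plane are taken
   in R * R. *)
Definition complex_pair (R : realType) (z : R[i]) : R * R :=
  (complex.Re z, complex.Im z).

Definition random_poly (T : Type) (R : realType) (n : nat)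
    (A : 'I_n.+1 -> T -> R) (w : T) : {poly R[i]} :=
  \sum_(i < n.+1) (A i w)%:C *: 'X^i.

(* Main.v *)
(* With z = e^(i t), |sum_k a_k z^k|^2 = sum_(k, l) a_k a_l cos (k t - l t), whose
   average over a uniform angle t is sum_k a_k^2, because cos (m t) has mean zero
   for m <> 0. As z is independent of the coefficients, Tonelli gives
   E |P(z)|^2 = sum_k E A_k^2, and E A_k^2 <= 1 follows from the derivative
   (- x p)' = x^2 p - p of the Gaussian density p, integrated over [-N, N].
   Markov's inequality for |P(z)|^2 concludes. *)
Require Import Defs.
From HB Require Import structures.
From mathcomp Require Import all_boot all_order all_algebra.
From mathcomp Require Import all_classical all_reals all_analysis.
From mathcomp Require Import complex.
From mathcomp Require Import measurable_realfun normal_distribution.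
From mathcomp Require Import uniform_distribution ring.

Set Implicit Arguments.
Unset Strict Implicit.
Unset Printing Implicit Defensive.

Import Order.TTheory GRing.Theory Num.Theory.
Import numFieldNormedType.Exports.

Local Open Scope classical_set_scope.
Local Open Scope ring_scope.
Local Open Scope complex_scope.

(** * Squared modulus of a polynomial on the unit circle *)

Lemma expi_exp (R : realType) (t : R) (k : nat) :
  expi t ^+ k = expi (t *+ k).
Proof.
elim: k => [|k IH]; first by rewrite mulr0n /expi cos0 sin0.
rewrite exprS IH mulrS /expi cosD sinD /=.
by congr (_ +i* _); ring.
Qed.

(** The modulus on [R[i]] is itself an element of [R[i]]; its square is taken in [R] so that it can
    be integrated. *)
Definition normsq (R : realType) (z : R[i]) : R :=
  complex.Re z ^+ 2 + complex.Im z ^+ 2.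

Lemma normsq_ge0 (R : realType) (z : R[i]) : 0 <= normsq z.
Proof. by rewrite addr_ge0// sqr_ge0. Qed.

Lemma normc_normsq (R : realType) (z : R[i]) : `|z| = (Num.sqrt (normsq z))%:C.
Proof. by case: z. Qed.

Lemma Re_sum_scale (R : realType) (I : finType) (a : I -> R) (z : I -> R[i]) :
  complex.Re (\sum_i (a i)%:C * z i) = \sum_i a i * complex.Re (z i).
Proof.
rewrite raddf_sum/=; apply: eq_bigr => i _.
by case: (z i) => x y /=; rewrite mul0r subr0.
Qed.

Lemma Im_sum_scale (R : realType) (I : finType) (a : I -> R) (z : I -> R[i]) :
  complex.Im (\sum_i (a i)%:C * z i) = \sum_i a i * complex.Im (z i).
Proof.
rewrite raddf_sum/=; apply: eq_bigr => i _.
by case: (z i) => x y /=; rewrite mul0r addr0.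
Qed.

(** The squares of the real and imaginary parts are double sums with weights [cos * cos] and
    [sin * sin], which the subtraction formula for the cosine merges. *)
Lemma normsq_sum_expi (R : realType) (I : finType) (a : I -> R) (t : I -> R) :
  normsq (\sum_i (a i)%:C * expi (t i)) =
  \sum_i \sum_j a i * a j * cos (t i - t j).
Proof.
rewrite /normsq Re_sum_scale Im_sum_scale !expr2 !big_distrlr/= -big_split/=.
apply: eq_bigr => i _; rewrite -big_split/=; apply: eq_bigr => j _.
by rewrite cosB; ring.
Qed.

Lemma random_poly_horner (T : Type) (R : realType) (n : nat)
    (A : 'I_n.+1 -> T -> R) (w : T) (z : R[i]) :
  (random_poly A w).[z] = \sum_(i < n.+1) (A i w)%:C * z ^+ i.
Proof.
by rewrite /random_poly horner_sum; apply: eq_bigr => i _; rewrite !hornerE.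
Qed.

(** * Measurability of the squared modulus *)

Section measurability.
Context d (T : measurableType d) (R : realType).

(** Both parts go through one induction, since multiplying by [f w +i* g w] mixes them. *)
Lemma measurable_Re_Im_exp (f g : T -> R) (k : nat) :
  measurable_fun setT f -> measurable_fun setT g ->
  measurable_fun setT (fun w => complex.Re ((f w +i* g w) ^+ k)) /\
  measurable_fun setT (fun w => complex.Im ((f w +i* g w) ^+ k)).
Proof.
move=> mf mg; elim: k => [|k [mre mim]]; first by split; exact: measurable_cst.
split.
  rewrite [X in measurable_fun _ X](_ : _ = fun w =>
      f w * complex.Re ((f w +i* g w) ^+ k) -
      g w * complex.Im ((f w +i* g w) ^+ k)); last first.
    by apply/funext => w; rewrite exprS; case: (_ ^+ k).
  by apply: measurable_funB; exact: measurable_funM.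
rewrite [X in measurable_fun _ X](_ : _ = fun w =>
    f w * complex.Im ((f w +i* g w) ^+ k) +
    g w * complex.Re ((f w +i* g w) ^+ k)); last first.
  by apply/funext => w; rewrite exprS; case: (_ ^+ k) => x y /=.
by apply: measurable_funD; exact: measurable_funM.
Qed.

Lemma measurable_normsq_sum (I : finType) (a : I -> T -> R) (z : I -> T -> R[i]) :
  (forall i, measurable_fun setT (a i)) ->
  (forall i, measurable_fun setT (fun w => complex.Re (z i w))) ->
  (forall i, measurable_fun setT (fun w => complex.Im (z i w))) ->
  measurable_fun setT (fun w => normsq (\sum_i (a i w)%:C * z i w)).
Proof.
move=> ma mre mim; rewrite /normsq.
under eq_fun do rewrite Re_sum_scale Im_sum_scale.
by apply: measurable_funD; apply: measurable_funX; apply: measurable_sum => i;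
  exact: measurable_funM.
Qed.

End measurability.

(** * Integration against densities and under independence *)

Lemma ge0_integral_density d (T : measurableType d) (R : realType)
    (nu : {finite_measure set T -> \bar R})
    (mu : {sigma_finite_measure set T -> \bar R}) (f : T -> R) (g : T -> \bar R) :
  nu `<< mu -> mu.-integrable setT (EFin \o f) ->
  (forall A, measurable A -> nu A = \int[mu]_(x in A) (f x)%:E)%E ->
  measurable_fun setT g -> (forall x, 0 <= g x)%E ->
  (\int[nu]_x g x = \int[mu]_x (g x * (f x)%:E))%E.
Proof.
move=> numu intf nuE mg g0.
(* The Radon-Nikodym derivative and [f] have the same integral over every measurable set, so they
   agree almost everywhere and the change of variables holds with [f]. *)
have intRN := Radon_Nikodym_SigmaFinite.f_integrable numu.
rewrite -(Radon_Nikodym_SigmaFinite.change_of_variables numu)//.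
apply: ae_eq_integral => //.
- by apply: emeasurable_funM => //; exact: measurable_int intRN.
- by apply: emeasurable_funM => //; exact: measurable_int intf.
- apply: ae_eqe_mul2l; apply: integral_ae_eq => //.
    exact: measurable_int intf.
  by move=> E _ mE; rewrite -nuE// -Radon_Nikodym_SigmaFinite.f_integral.
Qed.

Section tonelli.
Local Open Scope ereal_scope.
Context d d1 d2 (T : measurableType d) (S1 : measurableType d1)
  (S2 : measurableType d2) (R : realType) (P : probability T R).

(** Independence makes the joint law the product of the two laws, so Tonelli turns the integral into
    an iterated one; each variable is then pulled back to its own copy of [T]. *)
Lemma independent2_integral (X : {mfun T >-> S1}) (Y : {mfun T >-> S2})
    (f : S1 * S2 -> \bar R) :
  independent2 P X Y -> measurable_fun setT f -> (forall p, 0 <= f p) ->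
  \int[P]_w f (X w, Y w) = \int[P]_w \int[P]_v f (X w, Y v).
Proof.
move=> XY mf f0.
have mXY : measurable_fun setT (fun w => (X w, Y w)).
  by apply/measurable_fun_pairP; split; exact: measurable_funPT.
pose Z : {mfun T >-> (S1 * S2)%type} := mfun_Sub (mem_set mXY).
transitivity (\int[distribution P Z]_p f p).
  by rewrite ge0_integral_distribution.
transitivity (\int[distribution P X \x distribution P Y]_p f p).
  (* A measure with the product values on measurable rectangles is the product measure, and
     independence gives exactly these values. *)
  apply: eq_measure_integral => A mA _; apply/esym.
  exact: product_measure_unique.
rewrite fubini_tonelli1// ge0_integral_distribution//; last 2 first.
- exact: measurable_fun_fubini_tonelli_F.
- by move=> x; exact: integral_ge0.
apply: eq_integral => w _ /=; rewrite /fubini_F ge0_integral_distribution//.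
exact: measurable_fun_pair2.
Qed.

End tonelli.

Lemma integral_itv_derive (R : realType) (F f : R -> R) (a b : R) :
  a < b -> (forall x : R, is_derive x 1 F (f x)) -> continuous f ->
  (\int[lebesgue_measure]_(x in `[a, b]) (f x)%:E = (F b)%:E - (F a)%:E)%E.
Proof.
move=> ab dF cf; apply: continuous_FTC2 => //.
- exact: continuous_subspaceT.
- have cF x : {for x, continuous F}.
    by apply: differentiable_continuous; apply/derivable1_diffP.
  split.
  + by move=> x _; exact: ex_derive.
  + by apply: cvg_at_right_filter; exact: cF.
  + by apply: cvg_at_left_filter; exact: cF.
- by move=> x _; rewrite derive1E derive_val.
Qed.

(** * Second moment of the standard Gaussian *)

Section sqr_normal_pdf.
Context (R : realType).
Local Notation mu := (@lebesgue_measure R).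

Let pdf : R -> R := normal_pdf 0 1.

Let continuous_pdf : continuous pdf.
Proof. exact: continuous_normal_pdf. Qed.

Let is_derive_mul_pdf (x : R) :
  is_derive x 1 (fun x => - x * pdf x) (x ^+ 2 * pdf x - pdf x).
Proof.
rewrite /pdf normal_pdfE// /normal_fun.
apply: is_derive_eq; rewrite /GRing.scale/= subr0.
by move: (expR _) => E; field.
Qed.

Let integral_sqr_pdf_itv (n : nat) :
  (\int[mu]_(x in `[(- n.+1%:R)%R, n.+1%:R%R]) (x ^+ 2 * pdf x)%:E <= 1)%E.
Proof.
set N : R := n.+1%:R.
have N0 : 0 < N by rewrite ltr0n.
have NN : - N < N by rewrite gtrN.
have c2 : continuous (fun x : R => x ^+ 2 * pdf x).
  by move=> x; apply: cvgM; [exact: sqr_continuous|exact: continuous_pdf].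
have cptI : compact `[- N, N] by exact: segment_compact.
have i2 : mu.-integrable `[- N, N] (EFin \o (fun x => x ^+ 2 * pdf x)).
  by apply: continuous_compact_integrable => //; exact: continuous_subspaceT.
have ip : mu.-integrable `[- N, N] (EFin \o pdf).
  by apply: continuous_compact_integrable => //; exact: continuous_subspaceT.
have := integral_itv_derive NN is_derive_mul_pdf.
have cd : continuous (fun x : R => x ^+ 2 * pdf x - pdf x).
  by move=> x; apply: cvgB; [exact: c2|exact: continuous_pdf].
move=> /(_ cd).
under eq_integral do rewrite EFinB.
rewrite integralB//= => /eqP; rewrite sube_eq; last 2 first.
- exact: (integrable_fin_num _ i2).
- by apply: fin_num_adde_defr.
(* The integral is now a boundary term plus the integral of [pdf] over the interval. The former is
   [- N * (pdf N + pdf (- N))], which is nonpositive; the latter is at most the total mass 1. *)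
move=> /eqP ->; rewrite -[leRHS]add0e; apply: leeD.
  rewrite -EFinD lee_fin opprK mulNr -opprD oppr_le0 -mulrDr.
  by apply: mulr_ge0; [exact: ltW|apply: addr_ge0; exact: normal_pdf_ge0].
rewrite -(integral_normal_pdf 0 1); apply: ge0_subset_integral => //.
- by apply/measurable_EFinP; exact: measurable_normal_pdf.
- by move=> x _; rewrite lee_fin normal_pdf_ge0.
Qed.

(** Monotone convergence along the intervals [[-N, N]]. An upper bound suffices for Markov's
    inequality, so the boundary terms need only a sign, not a limit. *)
Lemma integral_sqr_normal_pdf :
  (\int[mu]_x (x ^+ 2 * normal_pdf 0 1 x)%:E <= 1)%E.
Proof.
pose F n : set R := `[- n.+1%:R, n.+1%:R]%classic.
have FT : \bigcup_n F n = setT.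
  apply/seteqP; split => // x _; exists (Num.truncn `|x|) => //.
  by rewrite /F/= in_itv/= -ler_norml ltW// truncnS_gt.
rewrite -FT; set f := fun x : R => (x ^+ 2 * normal_pdf 0 1 x)%:E.
have cvF : (\int[mu]_(x in F n) f x)%E @[n --> \oo] -->
    (\int[mu]_(x in \bigcup_n F n) f x)%E.
  apply: ge0_nondecreasing_set_cvg_integral => //.
  + move=> m n mn; apply/subsetPset => x; rewrite /F/= !in_itv/= -!ler_norml.
    by move=> /le_trans; apply; rewrite ler_nat.
  + by move=> i; exact: measurable_itv.
  + move=> i; apply: measurable_funTS; apply/measurable_EFinP.
    by apply: measurable_funM => //; exact: measurable_normal_pdf.
  + by move=> i x _; rewrite lee_fin mulr_ge0 ?sqr_ge0 ?normal_pdf_ge0.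
apply: (cvge_to_le cvF); near=> n; exact: integral_sqr_pdf_itv.
Unshelve. all: by end_near. Qed.

End sqr_normal_pdf.

(* The law of [X] is compared setwise rather than through [has_law] because
   [normal_prob] and [uniform_prob] are measures on [measurableTypeR R], whose
   display differs from that of [R]. *)
Lemma ge0_integral_law d d' (T : measurableType d) (S : measurableType d')
    (R : realType) (P : probability T R) (X : T -> S)
    (mu : {measure set S -> \bar R}) (f : S -> \bar R) :
  measurable_fun setT X ->
  (forall B, measurable B -> P (X @^-1` B) = mu B) ->
  measurable_fun setT f -> (forall x, 0 <= f x)%E ->
  (\int[P]_w f (X w) = \int[mu]_x f x)%E.
Proof.
move=> mX Xmu mf f0; pose Y : {mfun T >-> S} := mfun_Sub (mem_set mX).
rewrite -[LHS](ge0_integral_distribution Y mf f0).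
by apply: eq_measure_integral => A mA _; exact: Xmu.
Qed.

Lemma normal_second_moment d (T : measurableType d) (R : realType)
    (P : probability T R) (X : {RV P >-> R}) :
  has_law X (normal_prob 0 1) -> (\int[P]_w (X w ^+ 2)%:E <= 1)%E.
Proof.
move=> Xnormal; rewrite (@ge0_integral_law _ _ _ (measurableTypeR R) _ P X
  (normal_prob 0 1) (fun x : R => (x ^+ 2)%:E))//; last 3 first.
- exact: (measurable_funPT X).
- by apply/measurable_EFinP; exact: measurable_funX.
- by move=> x; rewrite lee_fin sqr_ge0.
rewrite (@ge0_integral_density _ _ _ _ lebesgue_measure (normal_pdf 0 1))//.
- under eq_integral do rewrite -EFinM; exact: integral_sqr_normal_pdf.
- exact: normal_prob_dominates.
- exact: integrable_normal_pdf.
- by apply/measurable_EFinP; exact: measurable_funX.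
- by move=> x; rewrite lee_fin sqr_ge0.
Qed.

(** * Orthogonality for a uniform angle *)

Section uniform_angle.
Context (R : realType).

(** The added 1 makes the integrand nonnegative, as [integral_uniform] requires; the result says
    that [cos (x *+ k)] has mean zero. *)
Lemma integral_uniform_cos (k : nat) : (0 < k)%N ->
  (\int[uniform_prob (pi2_gt0 R)]_x (1 + cos (x *+ k))%:E = 1)%E.
Proof.
move=> k0.
have kR : k%:R != 0 :> R by rewrite pnatr_eq0 -lt0n.
have cc : continuous (fun x : R => 1 + cos (x *+ k)).
  move=> x; apply: cvgD; first exact: cvg_cst.
  apply: continuous_comp; last exact: continuous_cos.
  exact: natmul_continuous.
rewrite integral_uniform; last 2 first.
- by apply/measurable_EFinP; exact: continuous_measurable_fun.
- by move=> x; rewrite lee_fin -lerBlDl sub0r cos_geN1.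
have dF (x : R) :
    is_derive x 1 (fun x => x + k%:R^-1 * sin (x * k%:R)) (1 + cos (x *+ k)).
  apply: is_derive_eq; rewrite /GRing.scale/= mulr0 add0r mulr1 (mulr_natr x).
  by rewrite mulrCA mulVf// mulr1.
(* The oscillating part of the antiderivative vanishes at both endpoints, leaving the length
   [2 * pi], which the uniform density normalises to 1. *)
have sin2pik : sin (2 * pi * k%:R) = 0 :> R.
  rewrite mulr_natr mulr_natl -[X in sin X]add0r.
  by rewrite (periodicn (@sinD2pi R)) sin0.
rewrite (integral_itv_derive (pi2_gt0 R) dF cc) mul0r sin0 sin2pik.
rewrite !mulr0 !addr0 sube0 subr0 -EFinM mulVf// gt_eqF//; exact: pi2_gt0.
Qed.

Lemma measurable_fun_natmul d (T : measurableType d) (g : T -> R) (k : nat) :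
  measurable_fun setT g -> measurable_fun setT (fun w => g w *+ k).
Proof.
move=> mg; under eq_fun do rewrite -mulr_natr.
exact: measurable_funM.
Qed.

Lemma integrable_cos d (T : measurableType d) (P : probability T R)
    (g : T -> R) :
  measurable_fun setT g -> P.-integrable setT (fun w => (cos (g w))%:E).
Proof.
move=> mg; apply: (@le_integrable _ _ _ _ _ _ _ (EFin \o cst 1)) => //.
- apply/measurable_EFinP; apply: (measurableT_comp _ mg).
  exact: (continuous_measurable_fun (@continuous_cos R)).
- by move=> w _ /=; rewrite lee_fin normr1 ler_norml cos_geN1 cos_le1.
- exact: finite_measure_integrable_cst.
Qed.

Lemma uniform_cosB d (T : measurableType d) (P : probability T R)
    (t : {RV P >-> R}) (i j : nat) :
  has_law t (uniform_prob (pi2_gt0 R)) ->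
  (\int[P]_w (cos (t w *+ i - t w *+ j))%:E = (i == j)%:R%:E)%E.
Proof.
move=> tU; have [->|] := eqVneq i j.
  under eq_integral do rewrite subrr cos0.
  by rewrite integral_cst//= probability_setT mule1.
(* The cosine is even, so the indices may be ordered to make the natural number [i - j] a true
   difference. *)
wlog ji : i j / (j < i)%N.
  move=> H; case: (ltngtP i j) => // [ij _|ji _]; last first.
    by apply: H => //; rewrite gtn_eqF.
  under eq_integral do rewrite -cosN opprB.
  by apply: H => //; rewrite gtn_eqF.
move=> _; set f := fun x : R => cos (x *+ (i - j)).
have cf : continuous f.
  move=> x; apply: continuous_comp; last exact: continuous_cos.
  exact: natmul_continuous.
have i1 : P.-integrable setT (EFin \o cst 1) by exact: finite_measure_integrable_cst.
have intf : P.-integrable setT (EFin \o (f \o t)).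
  by have := integrable_cos P (measurable_fun_natmul (i - j) (measurable_funPT t)).
(* Writing the cosine as [(1 + cos) - 1] gives a nonnegative integrand, to which the transfer to the
   law of [t] applies. *)
have -> : (\int[P]_w (cos (t w *+ i - t w *+ j))%:E =
    \int[P]_w ((1 + f (t w))%:E - 1%:E))%E.
  apply: eq_integral => w _.
  by rewrite /f mulrnBr ?(ltnW ji)// -EFinB [1 + _]addrC addrK.
rewrite integralB//=; last first.
  under eq_fun do rewrite EFinD.
  exact: integrableD.
rewrite integral_cst//= probability_setT mule1.
rewrite (@ge0_integral_law _ _ _ (measurableTypeR R) _ P t
  (uniform_prob (pi2_gt0 R)) (fun x : R => (1 + f x)%:E))//; last 3 first.
- exact: (measurable_funPT t).
- apply/measurable_EFinP/measurable_funD => //.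
  exact: continuous_measurable_fun.
- by move=> x; rewrite lee_fin -lerBlDl sub0r cos_geN1.
by rewrite integral_uniform_cos ?subn_gt0// subee.
Qed.

End uniform_angle.

(** The coefficients are constants here: this evaluates the inner integral left by Tonelli. After
    expansion into a double sum, only the diagonal terms have nonzero mean. *)
Lemma parseval_uniform_angle (R : realType) d (T : measurableType d)
    (P : probability T R) (t : {RV P >-> R}) (n : nat) (a : 'I_n -> R) :
  has_law t (uniform_prob (pi2_gt0 R)) ->
  (\int[P]_w (normsq (\sum_i (a i)%:C * expi (t w) ^+ i))%:E =
   (\sum_i a i ^+ 2)%:E)%E.
Proof.
move=> tU.
have intc (i j : 'I_n) :
    P.-integrable setT (fun w => (cos (t w *+ i - t w *+ j))%:E).
  apply: integrable_cos; apply: measurable_funB;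
    exact: (measurable_fun_natmul _ (measurable_funPT t)).
under eq_integral => w _.
  under eq_bigr do rewrite expi_exp.
  rewrite normsq_sum_expi -sumEFin.
  under eq_bigr do rewrite -sumEFin.
  over.
rewrite integral_sum//=; last first.
  move=> i; apply: integrable_sum => // j _.
  under eq_fun do rewrite EFinM; exact: integrableZl.
rewrite -sumEFin; apply: eq_bigr => i _.
rewrite integral_sum//=; last first.
  by move=> j; under eq_fun do rewrite EFinM; exact: integrableZl.
rewrite (bigD1 i)//= big1 => [|j ji].
  under eq_integral do rewrite EFinM.
  by rewrite integralZl// uniform_cosB// eqxx mule1 adde0 expr2.
under eq_integral do rewrite EFinM.
by rewrite integralZl// uniform_cosB// eq_sym (inj_eq val_inj) (negbTE ji) mule0.
Qed.

(** * Second moment of the random polynomial on the circle *)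

Lemma second_moment_random_poly (R : realType) d (T : measurableType d)
    (P : probability T R) (n : nat) (A : 'I_n.+1 -> {RV P >-> R})
    (t : {RV P >-> R}) :
  (forall i, has_law (A i) (normal_prob 0 1)) ->
  has_law t (uniform_prob (pi2_gt0 R)) ->
  independent2 P (fun w => [tuple A i w | i < n.+1])
                 (fun w => complex_pair (expi (t w))) ->
  (\int[P]_w (normsq (random_poly (fun i => A i) w).[expi (t w)])%:E
     <= n.+1%:R%:E)%E.
Proof.
move=> A_normal t_uniform At.
(* The integrand as a function of exactly the two variables in the independence hypothesis: the
   tuple of coefficients and the point of the circle as a real pair. *)
pose f (p : n.+1.-tuple R * (R * R)) : \bar R :=
  (normsq (\sum_(i < n.+1) (tnth p.1 i)%:C * (p.2.1 +i* p.2.2) ^+ i))%:E.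
have mf : measurable_fun setT f.
  apply/measurable_EFinP; apply: measurable_normsq_sum => i.
  - exact: measurableT_comp (measurable_tnth i) measurable_fst.
  - apply: (measurable_Re_Im_exp i _ _).1; exact: measurableT_comp.
  - apply: (measurable_Re_Im_exp i _ _).2; exact: measurableT_comp.
have mX : measurable_fun setT (fun w => [tuple A i w | i < n.+1]).
  apply/measurable_fun_tnthP => i; rewrite /comp.
  under eq_fun do rewrite tnth_mktuple.
  exact: measurable_funPT.
have mY : measurable_fun setT (fun w => complex_pair (expi (t w))).
  apply/measurable_fun_pairP; split; rewrite /comp/=;
    apply: (measurableT_comp _ (measurable_funPT t)); apply: continuous_measurable_fun.
    exact: continuous_cos.
  exact: continuous_sin.
pose X : {mfun T >-> n.+1.-tuple R} := mfun_Sub (mem_set mX).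
pose Y : {mfun T >-> (R * R)%type} := mfun_Sub (mem_set mY).
have fE w v : f (X w, Y v) = (normsq (\sum_i (A i w)%:C * expi (t v) ^+ i))%:E.
  by rewrite /f/=; under eq_bigr do rewrite tnth_mktuple.
rewrite (_ : integral _ _ _ = \int[P]_w f (X w, Y w))%E; last first.
  by apply: eq_integral => w _; rewrite fE random_poly_horner.
rewrite independent2_integral//; last by move=> p; rewrite lee_fin normsq_ge0.
under eq_integral => w _.
  under eq_integral do rewrite fE.
  rewrite parseval_uniform_angle// -sumEFin; over.
rewrite ge0_integral_sum//=; last 2 first.
- by move=> i; apply/measurable_EFinP/measurable_funX; exact: measurable_funPT.
- by move=> i w _; rewrite lee_fin sqr_ge0.
(* The bound becomes a sum of ones over the indices, to be compared term by term with the second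
   moments of the coefficients. *)
rewrite -[X in X%:R]card_ord -sumr_const -sumEFin.
by apply: lee_sum => i _; exact: normal_second_moment.
Qed.

(** * Markov's inequality for the squared modulus *)

Theorem theorem3p2 (R : realType) (d : measure_display) (T : measurableType d)
    (P : probability T R) (n : nat)
    (A : 'I_n.+1 -> {RV P >-> R}) (t : {RV P >-> R}) (z : T -> R[i])
    (A_normal : forall i, has_law (A i) (normal_prob 0 1))
    (A_indep : mutually_independent P (fun i w => A i w))
    (t_uniform : has_law t (uniform_prob (pi2_gt0 R)))
    (z_circle : forall w, z w = expi (t w))
    (z_indep : independent2 P (fun w => [tuple A i w | i < n.+1])
                              (fun w => complex_pair (z w)))
    (c : R) (c_gt0 : 0 < c) :
  (P [set w | (c * Num.sqrt n.+1%:R)%:C < `| (random_poly (fun i => A i) w).[z w] |]%R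
     <= (1 / c ^+ 2)%:E)%E.
Proof.
move: z_indep; have -> : z = fun w => expi (t w) by exact/funext.
move=> At; have := second_moment_random_poly A_normal t_uniform At.
set S := fun w => normsq (random_poly (fun i => A i) w).[expi (t w)].
move=> S_le.
have n0 : 0 < n.+1%:R :> R by rewrite ltr0n.
have mS : measurable_fun setT S.
  rewrite /S; under eq_fun do rewrite random_poly_horner.
  have [mc ms] : measurable_fun setT (cos \o t) /\ measurable_fun setT (sin \o t).
    split; apply: (measurableT_comp _ (measurable_funPT t));
      apply: continuous_measurable_fun.
      exact: continuous_cos.
    exact: continuous_sin.
  apply: measurable_normsq_sum => i.
  - exact: measurable_funPT.
  - exact: (measurable_Re_Im_exp i mc ms).1.
  - exact: (measurable_Re_Im_exp i mc ms).2.
have e0 : 0 < c ^+ 2 * n.+1%:R by rewrite mulr_gt0 ?exprn_gt0.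
(* The threshold is put under one square root, so that by monotonicity the event becomes
   [c ^+ 2 * n.+1%:R < S w]. *)
have cE : c * Num.sqrt n.+1%:R = Num.sqrt (c ^+ 2 * n.+1%:R).
  by rewrite sqrtrM ?sqr_ge0// sqrtr_sqr gtr0_norm.
have -> : [set w | (c * Num.sqrt n.+1%:R)%:C <
    `|(random_poly (fun i => A i) w).[expi (t w)]|] =
    [set w | c ^+ 2 * n.+1%:R < S w].
  apply/funext => w; apply/propext; rewrite /= normc_normsq ltcR -/(S w) cE.
  by rewrite ltNge ler_psqrt ?nnegrE ?normsq_ge0// -?ltNge// ltW.
have mST : measurable_fun setT (EFin \o S) by exact/measurable_EFinP.
(* The bound is recast as the second moment bound [n.+1%:R] divided by the threshold for [S]. *)
rewrite (_ : 1 / c ^+ 2 = (c ^+ 2 * n.+1%:R)^-1 * n.+1%:R); last first.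
  by field; rewrite gt_eqF//= gt_eqF.
rewrite EFinM lee_pdivlMl//; apply: le_trans S_le.
(* [le_integral_abse] is Markov's inequality for an absolute value and a non-strict threshold: [S]
   is nonnegative, and the strict event is included in the non-strict one. *)
rewrite (eq_integral (fun w => `|(S w)%:E|%E)); last first.
  by move=> w _; rewrite gee0_abs// lee_fin normsq_ge0.
apply: le_trans (le_integral_abse P measurableT mST e0).
apply: lee_pmul => //; first by rewrite lee_fin ltW.
have mge (x : R) : measurable (setT `&` [set w | ((x%:E <= `|(S w)%:E|)%E)]).
  by apply: emeasurable_fun_c_infty => //; exact: measurableT_comp.
apply: le_measure; rewrite ?inE//.
  have := emeasurable_fun_o_infty measurableT mST (c ^+ 2 * n.+1%:R)%:E.
  by rewrite setTI.
move=> w /= Sw; split => //.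
by rewrite lee_fin ger0_norm ?normsq_ge0// ltW.
Qed.
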